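(* Let $M=\mathbb{P}$ be the Riemann sphere, $a=\infty$, and let $\sigma(z)=\frac1z$ be the standard local coordinate at $\infty$. Then for any two polynomials $f,g\in\mathbb{C}[z]$ (not identically zero), the reduced resultant with respect to $\sigma$ equals the polynomial resultant: $$\mathcal{R}_\sigma(f,g)=\mathcal{R}_{\mathrm{pol}}(f,g).$$
   Context: For polynomials $f(z)=f_m\prod_{i=1}^m(z-a_i)$, $g(z)=g_n\prod_{j=1}^n(z-c_j)$ with $f_m,g_n\ne0$, the polynomial resultant is $\mathcal{R}_{\mathrm{pol}}(f,g)=f_m^n g_n^m\prod_{i,j}(a_i-c_j)=f_m^n\prod_{i=1}^m g(a_i)$. Let $M$ be a compact Riemann surface and let $\operatorname{ord}_a(f)$ denote the order of a meromorphic function $f$ at $a$. The local symbol of meromorphic functions $f,g$ at $a$ is the nonzero complex number $$\tau_a(f,g)=(-1)^{\operatorname{ord}_af\,\operatorname{ord}_ag}\lim_{z\to a}\frac{f(z)^{\operatorname{ord}_ag}}{g(z)^{\operatorname{ord}_af}}$$ (it depends only on $f,g$ near $a$). Suppose that $\xi\mapsto\operatorname{ord}_\xi(f)\operatorname{ord}_\xi(g)$ is either $\ge0$ on all of $M\setminus\{a\}$ or $\le0$ on all of $M\setminus\{a\}$ (admissibility on $M\setminus\{a\}$; it holds for any two polynomials on $\mathbb{P}$ with $a=\infty$), and let $\sigma$ be a local coordinate at $a$ with $\sigma(a)=0$. The reduced resultant with respect to $\sigma$ is $$\mathcal{R}_\sigma(f,g)=\frac{\tau_a(\sigma,g)^{\operatorname{ord}_af}}{\tau_a(f,g)}\prod_{\xi\ne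 a}g(\xi)^{\operatorname{ord}_\xi f}.$$ *)

(* Defs.v *)
From HB Require Import structures.
From mathcomp Require Import all_boot all_order all_algebra.
From mathcomp Require Import complex.
From mathcomp Require Import all_classical all_reals all_analysis.

Set Implicit Arguments.
Unset Strict Implicit.
Unset Printing Implicit Defensive.

Import Order.TTheory GRing.Theory Num.Theory.
Import numFieldNormedType.Exports.

Local Open Scope classical_set_scope.
Local Open Scope ring_scope.

(* The usual topology of the complex plane, induced by the modulus. *)
HB.instance Definition _ (R : realType) := NormedModule.copy R[i] R[i]^o.

(* The Riemann sphere, with [Some z] for a finite point [z] and [None] for the
   point at infinity. Functions on it take values in the sphere as well, poles
   being mapped to infinity. *)
Notation sphere R := (one_point_compactification R[i]).
Notation infinity := (None : sphere _).

Section Sphere.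
Context {R : realType}.
Implicit Types (a z : sphere R) (f g : sphere R -> sphere R).

(* [0 * infinity] is indeterminate; the value 0 makes the operation associative.
   It does not matter in [reduced_resultant] below for admissible [f] and [g],
   i.e. if [ord f xi * ord g xi] has constant sign (in the weak sense) for
   [xi != a]: then 0 and infinity do not both occur in the product. *)
Definition sphere_mul (x y : sphere R) : sphere R :=
  match x, y with
  | Some u, Some v => Some (u * v)
  | Some u, None => if u == 0 then Some 0 else None
  | None, Some v => if v == 0 then Some 0 else None
  | None, None => None
  end.

(* The map [z |-> 1/z] of the sphere; it is also the standard local coordinate
   at infinity. *)
Definition sphere_inv (x : sphere R) : sphere R :=
  match x with
  | Some u => if u == 0 then None else Some u^-1
  | None => Some 0
  end.

Definition sphere_pow (x : sphere R) (n : int) : sphere R :=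
  let p := iter `|n|%N (sphere_mul x) (Some 1) in
  if 0 <= n then p else sphere_inv p.

Lemma sphere_mulA : associative sphere_mul.
Proof.
move=> [u|] [v|] [w|] //=; rewrite ?mulrA //.
- by rewrite mulf_eq0; case: (v == 0); case: (u == 0); rewrite ?mulr0.
- case u0: (u == 0) => /=; case w0: (w == 0) => //=.
  + by rewrite mulr0 mul0r.
  + by rewrite mul0r.
  + by rewrite mulr0.
- by case: (u == 0); rewrite /= ?eqxx.
- by rewrite mulf_eq0; case: (v == 0) => /=; case: (w == 0); rewrite ?mul0r.
- by case: (w == 0); rewrite /= ?eqxx.
Qed.

Lemma sphere_mulC : commutative sphere_mul.
Proof. by move=> [u|] [v|] //=; rewrite mulrC. Qed.

Lemma sphere_mul1 : left_id (Some 1) sphere_mul.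
Proof. by move=> [u|] /=; rewrite ?mul1r ?oner_eq0. Qed.

HB.instance Definition _ := Monoid.isComLaw.Build (sphere R) (Some 1)
  sphere_mul sphere_mulA sphere_mulC sphere_mul1.

(* The inverse of the local coordinate centred at [a], namely [z - c] at a
   finite point [c], and [1/z] at infinity. *)
Definition chart a (w : R[i]) : sphere R :=
  match a with
  | Some c => Some (c + w)
  | None => sphere_inv (Some w)
  end.

(* [f = w ^ n * h(w)] in a punctured neighbourhood of [a], where [w] is the
   local coordinate and [h] is holomorphic near 0 with [h(0) != 0]. *)
Definition has_ord f a (n : int) : Prop :=
  exists h : R[i] -> R[i],
    [/\ \forall w \near (0 : R[i]), derivable h w 1,
        h 0 != 0
      & \forall w \near (0 : R[i])^', f (chart a w) = Some (w ^ n * h w)].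

Definition ord f a : int := xget 0 [set n | has_ord f a n].

(* The limit is taken in the complex plane: if [f] and [g] are meromorphic and
   not identically zero, they are finite and nonzero near [a] away from [a]. *)
Definition local_symbol a f g : R[i] :=
  (-1) ^ (ord f a * ord g a) *
  lim (odflt 0 (f z) ^ ord g a / odflt 0 (g z) ^ ord f a @[z --> a^']).

Definition reduced_resultant (sigma : sphere R -> sphere R) a f g : sphere R :=
  sphere_mul
    (Some (local_symbol a sigma g ^ ord f a / local_symbol a f g))
    (\big[sphere_mul/Some 1]_(xi \in ~` [set a]) sphere_pow (g xi) (ord f xi)).

Definition poly_map (p : {poly R[i]}) (z : sphere R) : sphere R :=
  match z with
  | Some w => Some p.[w]
  | None => if (size p <= 1)%N then Some p`_0 else None
  end.

(* The roots of [p], repeated according to multiplicity. *)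
Definition poly_roots (p : {poly R[i]}) : seq R[i] :=
  sval (closed_field_poly_normal p).

Definition poly_resultant (f g : {poly R[i]}) : R[i] :=
  lead_coef f ^+ (size g).-1 * lead_coef g ^+ (size f).-1 *
  \prod_(x <- poly_roots f) \prod_(c <- poly_roots g) (x - c).

End Sphere.

(* Main.v *)
Require Import Defs.
From mathcomp Require Import all_boot all_order all_algebra.
From mathcomp Require Import complex.
From mathcomp Require Import all_classical all_reals all_analysis.
Import Order.TTheory GRing.Theory Num.Theory.
Import numFieldNormedType.Exports.
Local Open Scope classical_set_scope.
Local Open Scope complex_scope.
Local Open Scope ring_scope.
Set Implicit Arguments.
Unset Strict Implicit.
Unset Printing Implicit Defensive.

(** Write [m] and [n] for the degrees of [f] and [g]. Both sides are the product
    of [lead_coef f ^+ n] and the product of [g.[x]] over the roots [x] of [f],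
    with multiplicity.

    At a finite point [c] the order of [f] is the multiplicity of [c] as a root,
    so the factors of the reduced resultant at finite points multiply to the
    product of the [g.[x]] ([finite_points_product]). Splitting [g] into linear
    factors turns it into [lead_coef g ^+ m] times the double product of the
    differences of roots ([prod_horner_roots]).

    At infinity everything is read off from the leading term [c w ^ k] of a
    function in the coordinate [w = 1/z], which for a polynomial [f] is
    [lead_coef f * w ^ (- m)]. If [f] and [g] have the leading terms [b w ^ k]
    and [c w ^ l], the powers of [w] cancel in [f ^ l / g ^ k], so the local
    symbol is [(-1) ^ (k * l) * b ^ l / c ^ k] ([local_symbol_infinity]). The
    symbol of [1/z] and [g] raised to the power [- m] is then
    [(-1) ^ (m * n) * lead_coef g ^ m], and the symbol of [f] and [g] is
    [(-1) ^ (m * n) * lead_coef g ^ m / lead_coef f ^ n]; the quotient is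
    [lead_coef f ^+ n] ([infinity_factor]).

    Two facts make these readings legitimate. The leading exponent is unique
    ([leading_term_order_le]), so that [ord] is what it should be. And the
    punctured neighbourhoods of infinity are the images under [w |-> 1/w] of
    those of 0 ([chart_infinity_dnbhs]), so that limits at infinity can be
    computed in the coordinate; as neighbourhoods of infinity are complements of
    compact sets, this is the Heine-Borel theorem in the complex plane. *)

(** * Compactness in the complex plane and neighbourhoods of infinity *)

(** The bound is found by the covering characterization of compactness: near
    each [z], any [M > |z| + 1] is a bound. *)
Lemma compact_norm_bounded (K : numFieldType) (V : normedModType K) (A : set V) :
  compact A -> exists M : K, 0 < M /\ forall z, A z -> `|z| < M.
Proof.
move=> /compact_near_coveringP cA.
have /cA near_lt : forall z, A z ->
    \forall w \near z & M \near +oo%R, `|w| < (M : K).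
  move=> z _; near=> w M => /=.
  apply: (@lt_trans _ _ (`|z| + 1)).
    rewrite -ltrBlDl; apply: le_lt_trans (lerB_dist _ _) _.
    near: w; apply: cvgr_distC_lt => //; exact: cvg_id.
  near: M; apply: nbhs_pinfty_gt; rewrite ger0_real ?addr_ge0 //.
have near_M : \forall M \near +oo%R, 0 < (M : K) /\ A `<=` (fun z : V => `|z| < M).
  near=> M; split; near: M; last exact: near_lt.
  apply: nbhs_pinfty_gt; exact: real0.
by have [M ?] := filter_ex near_M; exists M.
Unshelve. all: by end_near. Qed.

Section Resultant.
Context {R : realType}.
Implicit Types (z w : R[i]).

Lemma real_complex_continuous : continuous (real_complex R : R -> R[i]).
Proof.
move=> x; apply/cvgrPdist_lt => e e0.
have ee : e = (complex.Re e)%:C by rewrite RRe_real ?gtr0_real.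
near=> y.
rewrite -rmorphB/= ee normc_def/= expr0n/= addr0 sqrtr_sqr ltcR.
near: y; apply: cvgr_dist_lt => //; by rewrite -ltcR -ee.
Unshelve. all: by end_near. Qed.

Lemma normc_ge_Im z : `|complex.Im z|%:C <= `|z|.
Proof.
by rewrite normc_def lecR -sqrtr_sqr ler_wsqrtr// lerDr sqr_ge0.
Qed.

(** A disk lies in a square, which is the continuous image of a product of two
    segments. *)
Lemma disk_sub_compact (M : R) :
  exists2 K : set R[i], (compact `&` closed) K & [set z | `|z| <= M%:C] `<=` K.
Proof.
pose sq := `[(- M), M]%classic `*` `[(- M), M]%classic.
pose F (p : R * R) : R[i] := p.1%:C + 'i%C * p.2%:C.
have cF : continuous F.
  move=> p; apply: cvgD.
    by apply: continuous_comp; [exact: cvg_fst|exact: real_complex_continuous].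
  apply: cvgM; first exact: cvg_cst.
  by apply: continuous_comp; [exact: cvg_snd|exact: real_complex_continuous].
have cK : compact (F @` sq).
  apply: continuous_compact; first exact/continuous_subspaceT.
  by apply: compact_setX; exact: segment_compact.
exists (F @` sq).
  by split => //; apply: compact_closed => //; apply: (@norm_hausdorff R[i] R[i]).
move=> z /= zM; exists (complex.Re z, complex.Im z); last by rewrite /F/= -complexE.
by split; rewrite /= in_itv/= -ler_norml -lecR;
  [exact: le_trans (normc_ge_Re z) zM | exact: le_trans (normc_ge_Im z) zM].
Qed.

(** A punctured disk around 0 inverts to the complement of a disk, which
    contains the complement of a compact set; conversely a compact set is
    bounded, so it misses the inverses of small numbers. *)
Lemma chart_infinity_dnbhs :
  chart (infinity : sphere R) @ (0 : R[i])^' = (infinity : sphere R)^'.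
Proof.
apply/seteqP; split=> P.
- rewrite /= nbhs_simpl => /nbhs_ballP[e /= e0 Pe].
  have [K [cK clK] diskK] := disk_sub_compact (complex.Re e^-1).
  exists K => // z -[[w nKw <-]|->]; last by move=> /eqP.
  move=> _.
  have ew : e^-1 < `|w|.
    rewrite real_ltNge ?normr_real ?gtr0_real ?invr_gt0//.
    apply/negP => wM; apply: nKw; apply: diskK => /=.
    by rewrite RRe_real // gtr0_real ?invr_gt0.
  have w0 : w != 0.
    by rewrite -normr_gt0 (lt_trans _ ew) ?invr_gt0.
  have := Pe w^-1; rewrite /= invr_eq0 (negPf w0) invrK; apply => //.
  by rewrite /ball/= sub0r normrN normfV invf_plt ?posrE ?normr_gt0.
- case=> K [/compact_norm_bounded[M [M0 KM]] _] KP.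
  rewrite /= nbhs_simpl; near=> w.
  have w0 : w != 0 by near: w; exact: nbhs_dnbhs_neq.
  apply: KP; rewrite /= ?(negPf w0) //; left; exists w^-1 => //= /KM.
  rewrite normfV invf_plt ?posrE ?normr_gt0//; apply/negP.
  rewrite -real_leNgt ?gtr0_real ?normr_gt0 ?invr_gt0// ltW//.
  by near: w; apply: dnbhs0_lt; rewrite invr_gt0.
Unshelve. all: by end_near. Qed.

(** * Leading terms, orders and local symbols *)

Lemma derivable1_cvg (K : numFieldType) (h : K -> K) (x : K) :
  derivable h x 1 -> h y @[y --> x^'] --> h x.
Proof.
move=> /derivable1_diffP/differentiable_continuous hx.
apply: cvg_trans hx => P; exact: nbhs_dnbhs.
Qed.

Lemma derivable_horner_num (K : numFieldType) (p : {poly K}) (x : K) :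
  derivable (horner p) x 1.
Proof.
elim/poly_ind: p => [|p c ih].
  rewrite (_ : horner 0 = cst 0); first exact: derivable_cst.
  by apply/funext => y; rewrite horner0.
rewrite (_ : horner _ = horner p * id + cst c); last first.
  by apply/funext => y; rewrite !hornerE.
apply: derivableD; last exact: derivable_cst.
by apply: derivableM => //; exact: derivable_id.
Qed.

Lemma cvg_exprz (K : numFieldType) (T : Type) (F : set_system T) (f : T -> K)
    {FF : Filter F} (a : K) (n : int) :
  a != 0 -> f @ F --> a -> (f x ^ n) @[x --> F] --> a ^ n.
Proof.
move=> a0 fa.
have cvg_expr m : (f x ^+ m) @[x --> F] --> a ^+ m.
  elim: m => [|m ih]; first exact: cvg_cst.
  under eq_fun do rewrite exprS.
  by rewrite exprS; apply: cvgM.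
case: n => m; first exact: cvg_expr.
by apply: cvgV; rewrite ?expf_neq0.
Qed.

(** The leading term [c w ^ n] of the Laurent expansion of [f] at [a]. For given
    [a] and [n], such a [c] exists exactly when [has_ord f a n]. *)
Definition leading_term (f : sphere R -> sphere R) (a : sphere R) (n : int)
    (c : R[i]) : Prop :=
  exists h : R[i] -> R[i],
    [/\ \forall w \near (0 : R[i]), derivable h w 1,
        h 0 = c, c != 0
      & \forall w \near (0 : R[i])^', f (chart a w) = Some (w ^ n * h w)].

(** If [n] exceeded [m], the unit factor of the first expansion would equal
    [w ^ (n - m)] times that of the second, and so tend to 0. *)
Lemma leading_term_order_le f a m n b c :
  leading_term f a m b -> leading_term f a n c -> (n <= m)%R.
Proof.
move=> [h [dh h0 b0 fh]] [k [dk k0 c0 fk]].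
rewrite leNgt; apply/negP => mn.
have := derivable1_cvg (nbhs_singleton dh); rewrite h0 => hb.
have := derivable1_cvg (nbhs_singleton dk); rewrite k0 => kc.
have [d nE] : exists d : nat, n = m + d.+1.
  exists `|n - m|%N.-1; rewrite prednK ?absz_gt0 ?subr_eq0 ?gt_eqF//.
  by rewrite gez0_abs ?subr_ge0 ?ltW// [m + _]addrC subrK.
have := derivable1_cvg (@derivable_horner_num R[i] 'X^(d.+1) 0).
rewrite hornerXn expr0n /= => w_cvg0.
have := cvgM w_cvg0 kc; rewrite mul0r => wk0.
have eq_h : \forall w \near (0 : R[i])^', (horner 'X^(d.+1) \* k) w = h w.
  near=> w; rewrite /= hornerXn.
  have w0 : w != 0 by near: w; exact: nbhs_dnbhs_neq.
  have fhw : f (chart a w) = Some (w ^ m * h w) by near: w.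
  have fkw : f (chart a w) = Some (w ^ n * k w) by near: w.
  apply: (mulfI (expfz_neq0 m w0)).
  rewrite exprnP mulrA -expfzDr// -nE.
  by apply: Some_inj; rewrite -fkw fhw.
have h_cvg0 := cvg_trans (near_eq_cvg eq_h) (wk0 _).
have b00 := cvg_unique (@norm_hausdorff R[i] R[i]) hb (h_cvg0 _ _).
by rewrite (b00 _) eqxx in b0.
Unshelve. all: by end_near. Qed.

Lemma ord_leading_term f a n c : leading_term f a n c -> ord f a = n.
Proof.
move=> fc; rewrite /ord; case: xgetP => [m _ [h [dh h0 fh]]|/(_ n)]; last first.
  by case; case: fc => h [? <-]; exists h.
have fm : leading_term f a m (h 0) by exists h.
apply/eqP; rewrite eq_le (leading_term_order_le fc fm).
exact: leading_term_order_le fm fc.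
Qed.

Lemma local_symbol_infinity f g m n b c :
  leading_term f infinity m b -> leading_term g infinity n c ->
  local_symbol infinity f g = (-1) ^ (m * n) * (b ^ n / c ^ m).
Proof.
move=> fb gc; rewrite /local_symbol (ord_leading_term fb) (ord_leading_term gc).
congr *%R; rewrite -chart_infinity_dnbhs.
apply: cvg_lim; first exact: (@norm_hausdorff R[i] R[i]).
case: fb gc => [h [dh h0 b0 fh]] [k [dk k0 c0 gk]].
have := derivable1_cvg (nbhs_singleton dh); rewrite h0 => hb.
have := derivable1_cvg (nbhs_singleton dk); rewrite k0 => kc.
have cm0 : c ^ m != 0 by rewrite expfz_neq0.
have lim_hk := cvgM (cvg_exprz (n := n) b0 hb)
  (cvgV cm0 (cvg_exprz (n := m) c0 kc)).
have eq_fg : \forall w \near (0 : R[i])^', h w ^ n * (k w ^ m)^-1 =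
    odflt 0 (f (chart infinity w)) ^ n / odflt 0 (g (chart infinity w)) ^ m.
  near=> w.
  have w0 : w != 0 by near: w; exact: nbhs_dnbhs_neq.
  have fw : f (chart infinity w) = Some (w ^ m * h w) by near: w.
  have gw : g (chart infinity w) = Some (w ^ n * k w) by near: w.
  rewrite fw gw /= !expfzMl !exprz_exp [n * m]mulrC.
  by rewrite -mulf_div divff ?mul1r// expfz_neq0.
exact: cvg_trans (near_eq_cvg eq_fg) (lim_hk _ _ _ _).
Unshelve. all: by end_near. Qed.

Lemma leading_term_sphere_inv : leading_term sphere_inv infinity 1 1.
Proof.
exists (cst 1); split; [|by []|exact: oner_neq0|].
  near=> w; exact: derivable_cst.
near=> w; rewrite /= mulr1 expr1z.
have w0 : w != 0 by near: w; exact: nbhs_dnbhs_neq.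
by rewrite (negPf w0) /= invr_eq0 (negPf w0) invrK.
Unshelve. all: by end_near. Qed.

(** * Leading terms of polynomials *)

Lemma leading_term_root (q : {poly R[i]}) (c : R[i]) (n : nat) :
  q.[c] != 0 -> leading_term (poly_map (q * ('X - c%:P) ^+ n)) (Some c) n q.[c].
Proof.
move=> qc; exists (horner (q \Po ('X + c%:P))); split => //.
- near=> w; exact: derivable_horner_num.
- by rewrite horner_comp !hornerE.
- near=> w; rewrite /= horner_comp !hornerE.
  by rewrite [c + w]addrC addrK mulrC.
Unshelve. all: by end_near. Qed.

(** The analytic factor is the reciprocal polynomial, with the coefficients in
    reverse order, whose value at 0 is the leading coefficient of [f]. *)
Lemma leading_term_poly_infinity (f : {poly R[i]}) : f != 0 ->
  leading_term (poly_map f) infinity (- ((size f).-1)%:Z) (lead_coef f).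
Proof.
move=> f0; set m := (size f).-1.
exists (horner (\poly_(i < m.+1) f`_(m - i))); split => //.
- near=> w; exact: derivable_horner_num.
- by rewrite horner_coef0 coef_poly /= subn0.
- by rewrite lead_coef_eq0.
near=> w.
have w0 : w != 0 by near: w; exact: nbhs_dnbhs_neq.
rewrite /= (negPf w0) /= horner_poly (reindex_inj rev_ord_inj) /=; congr Some.
have fm : size f = m.+1 by rewrite /m prednK ?size_poly_gt0.
rewrite horner_coef mulr_sumr fm; apply: eq_bigr => i _.
have im : (i <= m)%N by rewrite -ltnS.
rewrite subSS subKn// -invr_expz mulrCA; congr *%R.
apply: (mulfI (expf_neq0 m w0)); rewrite mulVKf ?expf_neq0// exprVn.
by rewrite -{1}(subnK im) exprD mulfK ?expf_neq0.
Unshelve. all: by end_near. Qed.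

Lemma leading_term_finite (f : {poly R[i]}) (c : R[i]) : f != 0 ->
  exists b, leading_term (poly_map f) (Some c) (count_mem c (poly_roots f))%:Z b.
Proof.
rewrite /poly_roots; case: closed_field_poly_normal => s /= fE f0.
(* The factors of [f] other than [X - c], whose product is not 0 at [c]. *)
pose q := lead_coef f *: \prod_(z <- s | z != c) ('X - z%:P).
exists q.[c].
rewrite fE (bigID (pred1 c)) /= mulrC scalerAl -/q.
rewrite (eq_bigr (fun=> 'X - c%:P)) => [|z /eqP -> //].
rewrite big_const_seq iter_mulr_1; apply: leading_term_root.
rewrite hornerZ mulf_neq0 ?lead_coef_eq0// horner_prod.
rewrite prodf_seq_neq0; apply/allP => z _; apply/implyP => zc.
by rewrite hornerXsubC subr_eq0 eq_sym.
Qed.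

(** * The factors of the reduced resultant *)

Lemma sphere_pow_nat (u : R[i]) (n : nat) : sphere_pow (Some u) n = Some (u ^+ n).
Proof. by rewrite /sphere_pow /=; elim: n => //= n ->; rewrite /= exprS. Qed.

(** Points other than the roots of [f] have order 0 and contribute 1, so that the
    product is one over the distinct roots. *)
Lemma finite_points_product (f g : {poly R[i]}) : f != 0 ->
  \big[@sphere_mul R/Some 1]_(xi \in ~` [set infinity])
      sphere_pow (poly_map g xi) (ord (poly_map f) xi) =
  Some (\prod_(x <- poly_roots f) g.[x]).
Proof.
move=> f0; set s := poly_roots f.
have powE c : sphere_pow (poly_map g (Some c)) (ord (poly_map f) (Some c)) =
    Some (g.[c] ^+ count_mem c s).
  have [b /ord_leading_term ->] := leading_term_finite c f0.
  exact: sphere_pow_nat.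
rewrite -(fsbig_widen [set` (map Some (undup s) : seq (sphere R))]).
- rewrite -fsbig_seq; last by rewrite map_inj_uniq ?undup_uniq// => x y [].
  rewrite big_map (eq_bigr _ (fun c _ => powE c)).
  rewrite -(big_morph Some (id2 := 1) (op2 := *%R)) //.
  by rewrite big_undup_iterop_count.
- by move=> _ /= /mapP[c _ ->].
- case=> [c|[/(_ erefl)]//] [_ /= cs].
  rewrite powE (count_memPn _) ?expr0//.
  by apply/negP => cin; apply: cs; rewrite mem_map ?mem_undup// => x y [].
Qed.

Lemma prod_horner_roots (f g : {poly R[i]}) : f != 0 ->
  \prod_(x <- poly_roots f) g.[x] = lead_coef g ^+ (size f).-1 *
    \prod_(x <- poly_roots f) \prod_(c <- poly_roots g) (x - c).
Proof.
move=> f0; have gE x : g.[x] = lead_coef g * \prod_(c <- poly_roots g) (x - c).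
  rewrite /poly_roots; case: closed_field_poly_normal => s /= {1}->.
  by rewrite hornerZ horner_prod; under eq_bigr do rewrite hornerXsubC.
under eq_bigr do rewrite gE.
rewrite big_split /= big_const_seq count_predT iter_mulr_1; congr (_ ^+ _ * _).
rewrite /poly_roots; case: closed_field_poly_normal => s /= fE.
by rewrite fE size_scale ?lead_coef_eq0// size_prod_XsubC.
Qed.

Lemma infinity_factor (f g : {poly R[i]}) : f != 0 -> g != 0 ->
  local_symbol infinity sphere_inv (poly_map g) ^ ord (poly_map f) infinity /
    local_symbol infinity (poly_map f) (poly_map g) =
  lead_coef f ^+ (size g).-1.
Proof.
move=> f0 g0.
have lf := leading_term_poly_infinity f0; have lg := leading_term_poly_infinity g0.
rewrite (local_symbol_infinity leading_term_sphere_inv lg).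
rewrite (local_symbol_infinity lf lg) (ord_leading_term lf).
move: (size f).-1 (size g).-1 => m n.
have lf0 : lead_coef f != 0 by rewrite lead_coef_eq0.
have lg0 : lead_coef g != 0 by rewrite lead_coef_eq0.
rewrite mul1r mulrNN expfzMl exprz_exp mulrNN [n%:Z * _]mulrC.
rewrite -mulf_div divff ?mul1r ?expfz_neq0 ?oppr_eq0 ?oner_eq0//.
rewrite exp1rz mul1r expr1z exprz_inv opprK.
by rewrite -!invr_expz invrK invfM !invrK mulrCA mulfV ?mulr1 ?expfz_neq0.
Qed.

End Resultant.

Theorem corollary8 (R : realType) (f g : {poly R[i]})
    (f_neq0 : f != 0) (g_neq0 : g != 0) :
  reduced_resultant sphere_inv infinity (poly_map f) (poly_map g)
  = Some (poly_resultant f g).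
Proof.
rewrite /reduced_resultant infinity_factor// finite_points_product//=.
by rewrite prod_horner_roots// mulrA.
Qed.
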